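(* Let $P(t)$, $t\in[0,D]$, be the optimal policy. Then $P(t)$ is piecewise monotone decreasing except possibly at the energy arrival instants $s_1,\dots,s_N$; in particular, $P(t)$ is monotone decreasing (i.e., non-increasing) between consecutive energy harvests, that is, on each interval $(s_i,s_{i+1})$, $i=0,\dots,N$.
   Context: Fix a deadline $D>0$, constants $a,b>0$, an environment temperature $T_e$ and a critical temperature $T_c>T_e$; set $T_\delta=T_c-T_e$. Energy amounts $E_0,E_1,\dots,E_N>0$ become available at times $0=s_0<s_1<\dots<s_N<D$ respectively, and $s_{N+1}=D$. The instants $s_1,\dots,s_N$ are the energy arrival (harvesting) instants. For $t\in(0,D]$ let $h(t)=\max\{k: s_k<t\}$. A power policy is a measurable function $P:[0,D]\to[0,\infty)$. The resulting temperature $T(t)$ solves $\frac{d}{dt}T(t)=aP(t)-b(T(t)-T_e)$, $T(0)=T_e$, i.e. $T(t)=T_e+e^{-bt}\int_0^t ae^{b\tau}P(\tau)\,d\tau$. The optimal policy is the maximizer of $\int_0^D\frac12\log_2(1+P(\tau))\,d\tau$ over power policies satisfying the temperature constraint $T(t)\le T_c$ for all $t\in[0,D]$ (equivalently $\int_0^t ae^{b\tau}P(\tau)\,d\tau\le T_\delta e^{bt}$ for all $t$) and the energy causality constraint $\int_0^tP(\tau)\,d\tau\le\sum_{i=0}^{h(t)}E_i$ for all $t\in(0,D]$. It is unique almost everywhere; pointwise statements about it are understood after modification on a null set. *)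

(* Defs.v *)
From HB Require Import structures.
From mathcomp Require Import all_boot all_order all_algebra.
From mathcomp Require Import all_classical all_reals all_analysis.
Set Implicit Arguments.
Unset Strict Implicit.
Unset Printing Implicit Defensive.
Import Order.TTheory GRing.Theory Num.Theory.
Import numFieldNormedType.Exports.
Local Open Scope classical_set_scope.
Local Open Scope ring_scope.

(* All integrals are extended-real valued: the integrands are nonnegative and
   measurable, so they always make sense, and an infinite value violates the
   (finite) constraints. *)

Definition log2 (R : realType) (x : R) : R := ln x / ln 2.

(* Policies are total functions of which only the values on [0, D] matter. *)
Definition power_policy (R : realType) (D : R) (P : R -> R) : Prop :=
  measurable_fun `[0, D] P /\ {in `[0, D], forall t, 0 <= P t}.

(* The solution of T' = a P - b (T - Te), T(0) = Te. *)
Definition temperature (R : realType) (a b Te : R) (P : R -> R) (t : R)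
    : \bar R :=
  (Te%:E + (expR (- (b * t)))%:E *
    \int[lebesgue_measure]_(tau in `[0%R, t]) (a * expR (b * tau) * P tau)%:E)%E.

Definition temperature_constraint (R : realType) (D a b Te Tc : R)
    (P : R -> R) : Prop :=
  {in `[0, D], forall t, (temperature a b Te P t <= Tc%:E)%E}.

(* For t in ]0, D] the maximum is over a nonempty set (s 0 = 0 < t) and is at
   most N (s N.+1 = D). *)
Definition last_arrival (R : realType) (N : nat) (s : nat -> R) (t : R) : nat :=
  (\max_(k < N.+2 | (s k < t)%R) k)%N.

Definition energy_causality (R : realType) (D : R) (N : nat) (s E : nat -> R)
    (P : R -> R) : Prop :=
  {in `]0, D], forall t,
    (\int[lebesgue_measure]_(tau in `[0%R, t]) (P tau)%:E
      <= (\sum_(0 <= i < (last_arrival N s t).+1) E i)%:E)%E}.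

Definition throughput (R : realType) (D : R) (P : R -> R) : \bar R :=
  (\int[lebesgue_measure]_(tau in `[0%R, D]) (2^-1 * log2 (1 + P tau))%:E)%E.

Definition feasible_policy (R : realType) (D a b Te Tc : R) (N : nat)
    (s E : nat -> R) (P : R -> R) : Prop :=
  [/\ power_policy D P, temperature_constraint D a b Te Tc P
    & energy_causality D N s E P].

Definition optimal_policy (R : realType) (D a b Te Tc : R) (N : nat)
    (s E : nat -> R) (P : R -> R) : Prop :=
  feasible_policy D a b Te Tc N s E P /\
  forall P' : R -> R, feasible_policy D a b Te Tc N s E P' ->
    (throughput D P' <= throughput D P)%E.

(* Main.v *)
Require Import Defs.
From HB Require Import structures.
From mathcomp Require Import all_boot all_order all_algebra.
From mathcomp Require Import all_classical all_reals all_analysis.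
From mathcomp Require Import measurable_realfun ring lra.
Set Implicit Arguments.
Unset Strict Implicit.
Unset Printing Implicit Defensive.
Import Order.TTheory GRing.Theory Num.Theory.
Import numFieldNormedType.Exports.
Local Open Scope classical_set_scope.
Local Open Scope ring_scope.

(* Let K e^(bt) - G(t), with G(t) the integral of e^(bx) P(x) over [0, t] and
   K = (Tc - Te) / a, be the margin: the temperature constraint says that it is
   nonnegative, and almost everywhere its derivative is e^(bt) (bK - P(t)).

   Where the margin is positive throughout [x, y] inside one epoch, P cannot be
   low on a non-null early set A and high on a non-null later set B: moving a
   little energy from B to A keeps both constraints (within an epoch only the
   energy spent by its end matters, and earlier heat has decayed more by the end)
   and increases the throughput by strict concavity.

   Suppose P(t1) < P(t2) at times of one epoch at which the derivative formula
   holds. If the margin vanishes at one of the two times, then P = bK there, as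
   the margin has a minimum. If it vanishes somewhere on [t1, t2], then
   P(t1) < bK or P(t2) > bK. In the first case look just before the first zero:
   the margin decreases there, so P >= bK on a non-null set. In the second case
   look just after the last zero, where P <= bK on a non-null set. Either way the
   previous paragraph is contradicted, so P is nonincreasing along almost all
   times of the epoch, and suprema over later such times repair it elsewhere. *)

(** * Comparing and computing integrals with weight e^(bx) *)

Lemma le_Rintegral_null d (T : measurableType d)
    (R : realType) (mu : {measure set T -> \bar R}) (D N : set T) (f g : T -> R) :
  measurable D -> measurable N -> mu N = 0%E ->
  mu.-integrable D (EFin \o f) -> mu.-integrable D (EFin \o g) ->
  (forall x, D x -> ~ N x -> f x <= g x) ->
  \int[mu]_(x in D) f x <= \int[mu]_(x in D) g x.
Proof.
move=> mD mN N0 if_ ig fg.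
rewrite /Rintegral (negligible_integral mN mD if_ N0) (negligible_integral mN mD ig N0).
apply: le_Rintegral => [|||x [Dx Nx]]; last exact: fg.
- exact: measurableD.
- by apply: integrableS if_ => //; exact: measurableD.
- by apply: integrableS ig => //; exact: measurableD.
Qed.

Section ExpIntegral.
Context {R : realType}.
Notation mu := (@lebesgue_measure R).

(** The parameter [b] lets one family of lemmas serve both constraints: the cooling rate gives the
    accumulated heat, and [b = 0] gives the energy spent by time [t]. *)
Definition expint (b : R) (P : R -> R) (t : R) : R :=
  \int[mu]_(x in `[0, t]) (expR (b * x) * P x).

Lemma measurable_expRM (b : R) (D : set R) :
  measurable_fun D (fun x : R => expR (b * x)).
Proof.
apply: measurable_funTS; apply: measurableT_comp; first exact: measurable_expR.
exact: mulrl_measurable.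
Qed.

Lemma integrable_expRM (b u v : R) (P : R -> R) :
  mu.-integrable `[u, v] (EFin \o P) ->
  mu.-integrable `[u, v] (fun x => (expR (b * x) * P x)%:E).
Proof.
move=> iP.
apply: (eq_integrable (mu := mu) _ ((EFin \o (fun x : R => expR (b * x))) \* (EFin \o P))%E) => //.
apply: integrableMr => //; first exact: measurable_expRM.
(* On the interval the exponent [b * x] is at most |b| max(|u|, |v|), whatever the signs. *)
exists (expR (`|b| * Num.max `|u| `|v|)); split => [|M hM x /=]; first exact: num_real.
rewrite in_itv/= => /andP[ux xv].
rewrite ger0_norm ?expR_ge0// (le_trans _ (ltW hM))// ler_expR.
rewrite (le_trans (ler_norm _))// normrM ler_wpM2l//.
rewrite le_max; case: (lerP 0 x) => x0.
  by apply/orP; right; rewrite ger0_norm// (le_trans xv)// ler_norm.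
by apply/orP; left; rewrite ltr0_norm// lerNl (le_trans _ ux)// lerNl -normrN ler_norm.
Qed.

(** The weight is unbounded on the line; the bounded support reduces the claim to a compact
    interval. Differentiating [expint] almost everywhere uses this global form. *)
Lemma integrable_expRM_supp (b D : R) (P : R -> R) :
  mu.-integrable setT (EFin \o P) ->
  (forall x, ~ (`[0, D]%classic x) -> P x = 0) ->
  mu.-integrable setT (fun x => (expR (b * x) * P x)%:E).
Proof.
move=> iP P0.
have -> : (fun x => (expR (b * x) * P x)%:E) =
   (fun x => (expR (b * x) * P x)%:E) \_ `[0, D].
  apply/funext => x; rewrite patchE; case: ifPn => //.
  by rewrite notin_setE => /P0 ->; rewrite mulr0.
apply/(integrable_mkcond _ _).1 => //.
apply: integrable_expRM; exact: integrableS iP.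
Qed.

Lemma is_derive_expRM (b k t : R) :
  is_derive t 1 (fun t => k * expR (b * t)) (expR (b * t) * (b * k)).
Proof.
have -> : (fun t => k * expR (b * t)) = k \*: (expR \o (b \*: (@id R))) by [].
by apply: is_derive_eq; rewrite /GRing.scale /= mulr1; ring.
Qed.

Lemma continuous_expRM (b k : R) : continuous (fun t : R => k * expR (b * t) : R).
Proof.
move=> t; apply: differentiable_continuous; apply/derivable1_diffP.
exact: (@ex_derive _ _ _ _ _ _ _ (is_derive_expRM b k t)).
Qed.

Lemma Rintegral_expRM (b k x y : R) : x < y ->
  \int[mu]_(t in `[x, y]) (expR (b * t) * (b * k)) =
  k * expR (b * y) - k * expR (b * x).
Proof.
move=> xy; rewrite /Rintegral (@continuous_FTC2 _ _ (fun t => k * expR (b * t)))//.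
- apply: continuous_subspaceT => z; under eq_fun do rewrite mulrC.
  exact: continuous_expRM.
- split => [z _| |].
  + exact: (@ex_derive _ _ _ _ _ _ _ (is_derive_expRM b k z)).
  + by apply: cvg_at_right_filter; exact: continuous_expRM.
  + by apply: cvg_at_left_filter; exact: continuous_expRM.
- move=> z _; rewrite derive1E.
  exact: (@derive_val _ _ _ _ _ _ _ (is_derive_expRM b k z)).
Qed.

Lemma expintB (b x y : R) (P : R -> R) : 0 <= x -> x <= y ->
  mu.-integrable `[0, y] (EFin \o P) ->
  expint b P y - expint b P x = \int[mu]_(t in `[x, y]) (expR (b * t) * P t).
Proof.
move=> x0 xy iP.
have iE := integrable_expRM b iP.
rewrite /expint Rintegral_itvB//=.
apply: Rintegral_itv_obnd_cbnd.
apply: integrableS iE => //.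
by apply: subset_itvr; rewrite bnd_simp.
Qed.

End ExpIntegral.

(** * The margin, its level sets, and perturbation by indicators *)

Section Perturbation.
Context {R : realType}.
Notation mu := (@lebesgue_measure R).
Implicit Types (P : R -> R) (A B : set R).

(** [k] stays free: the value (Tc - Te) / a gives the temperature margin, other values compare [P]
    with other power levels. *)
Definition margin (b k : R) P (t : R) : R := k * expR (b * t) - expint b P t.

Lemma lt_itv_pinfty (u v : R) : (mu `[u, v] < +oo)%E.
Proof. by rewrite lebesgue_measure_itv/=; case: ifPn => _; rewrite ?ltry. Qed.

Lemma integrable_cst_itv (u v k : R) : mu.-integrable `[u, v] (EFin \o cst k).
Proof.
apply: measurable_bounded_integrable => //; first exact: lt_itv_pinfty.
exact: bounded_cst.
Qed.

(* The threshold [b * k] is the power that makes [margin b k P] stationary. *)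
Lemma margin_lt_level (b k x y : R) P : 0 <= x -> x < y ->
  mu.-integrable setT (EFin \o P) ->
  margin b k P x < margin b k P y ->
  mu (`[x, y] `&` [set t | P t <= b * k]) != 0%E.
Proof.
move=> x0 xy iP lt_xy; apply/eqP => N0; move: lt_xy; apply/negP; rewrite -leNgt.
have iS u v : mu.-integrable `[u, v] (EFin \o P) by exact: integrableS iP.
have /integrableP[/measurable_EFinP mP _] := iP.
have ik : mu.-integrable `[x, y] (EFin \o (cst (b * k))).
  exact: integrable_cst_itv.
(* Off the null set [P] exceeds [b * k], so the increment of [expint] dominates that of k e^(bt) and
   the margin cannot rise. *)
suff : k * expR (b * y) - k * expR (b * x) <= expint b P y - expint b P x by rewrite /margin; lra.
rewrite -(Rintegral_expRM b k xy) (expintB _ x0 (ltW xy) (iS _ _)).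
apply: (@le_Rintegral_null _ _ _ mu _ (`[x, y] `&` [set t | P t <= b * k])) => //.
- by apply: (@measurable_fun_le _ _ R) => //; exact: measurable_funTS mP.
- exact: integrable_expRM.
- exact: integrable_expRM.
- move=> t txy Nt; rewrite ler_wpM2l ?expR_ge0// leNgt; apply/negP => /ltW Pt.
  exact: Nt.
Qed.

(** Dually, if [P] were below [b * k] almost everywhere on the interval, the margin could not
    fall. *)
Lemma margin_gt_level (b k x y : R) P : 0 <= x -> x < y ->
  mu.-integrable setT (EFin \o P) ->
  margin b k P y < margin b k P x ->
  mu (`[x, y] `&` [set t | b * k <= P t]) != 0%E.
Proof.
move=> x0 xy iP lt_xy; apply/eqP => N0; move: lt_xy; apply/negP; rewrite -leNgt.
have iS u v : mu.-integrable `[u, v] (EFin \o P) by exact: integrableS iP.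
have /integrableP[/measurable_EFinP mP _] := iP.
have ik : mu.-integrable `[x, y] (EFin \o (cst (b * k))).
  exact: integrable_cst_itv.
suff : expint b P y - expint b P x <= k * expR (b * y) - k * expR (b * x) by rewrite /margin; lra.
rewrite -(Rintegral_expRM b k xy) (expintB _ x0 (ltW xy) (iS _ _)).
apply: (@le_Rintegral_null _ _ _ mu _ (`[x, y] `&` [set t | b * k <= P t])) => //.
- by apply: (@measurable_fun_le _ _ R) => //; exact: measurable_funTS mP.
- exact: integrable_expRM.
- exact: integrable_expRM.
- move=> t txy Nt; rewrite ler_wpM2l ?expR_ge0// leNgt; apply/negP => /ltW Pt.
  exact: Nt.
Qed.

Lemma integrableZl_EFin (D : set R) (c : R) (f : R -> R) : measurable D ->
  mu.-integrable D (EFin \o f) -> mu.-integrable D (EFin \o (fun x => c * f x)).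
Proof.
move=> mD if_; apply: (eq_integrable (mu := mu) mD (fun x => c%:E * (f x)%:E)%E) => //.
exact: integrableZl.
Qed.

Lemma integrable_indicS (D A : set R) : measurable D -> measurable A ->
  (mu D < +oo)%E -> mu.-integrable D (EFin \o \1_A).
Proof.
move=> mD mA Doo; apply: measurable_bounded_integrable => //.
exists 1; split => // M M1 x _ /=.
by rewrite indicE; case: (_ \in _); rewrite ?normr1 ?normr0 ltW// (lt_trans _ M1).
Qed.

Lemma expint_ge0 (b t : R) P : (forall x, 0 <= P x) -> 0 <= expint b P t.
Proof. by move=> P0; apply: Rintegral_ge0 => x _; rewrite mulr_ge0// expR_ge0. Qed.

Lemma le_expint (b s t : R) P : (forall x, 0 <= P x) ->
  mu.-integrable setT (EFin \o P) -> 0 <= s -> s <= t ->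
  expint b P s <= expint b P t.
Proof.
move=> P0 iP s0 st; rewrite -subr_ge0 expintB//; last exact: integrableS iP.
by apply: Rintegral_ge0 => x _; rewrite mulr_ge0// expR_ge0.
Qed.

(** The weight is at most e^(bp) on [A], and cutting [A] at [t] only loses mass. This bounds the
    heat added on the early set. *)
Lemma expint_indic_le (b p t : R) A : 0 <= b -> measurable A -> (mu A < +oo)%E ->
  (forall x, A x -> x <= p) ->
  expint b \1_A t <= expR (b * p) * fine (mu A).
Proof.
move=> b0 mA Aoo Ap; rewrite /expint.
apply: (@le_trans _ _ (\int[mu]_(x in `[0%R, t]) (expR (b * p) * \1_A x))).
  apply: le_Rintegral => //.
  - by apply: integrable_expRM; apply: integrable_indicS => //; exact: lt_itv_pinfty.
  - by apply: integrableZl_EFin => //; apply: integrable_indicS => //; exact: lt_itv_pinfty.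
  - move=> x _; rewrite indicE; case: (boolP (x \in A)) => xA; rewrite ?mulr0// !mulr1.
    by rewrite ler_expR ler_wpM2l// Ap//; exact/set_mem.
rewrite RintegralZl//; last first.
  by apply: integrable_indicS => //; exact: lt_itv_pinfty.
rewrite ler_wpM2l ?expR_ge0// /Rintegral integral_indic//.
apply: fine_le; rewrite ?ge0_fin_numE//.
  by rewrite (le_lt_trans _ Aoo)// le_measure// inE//; exact: measurableI.
by rewrite le_measure// inE//; exact: measurableI.
Qed.

(** The weight is at least e^(bq) on [A]; as [A] lies before [t], its whole mass counts. This bounds
    from below the heat removed on the late set. *)
Lemma expint_indic_ge (b q t : R) A : 0 <= b -> measurable A ->
  (forall x, A x -> q <= x) -> A `<=` `[0, t] ->
  expR (b * q) * fine (mu A) <= expint b \1_A t.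
Proof.
move=> b0 mA qA A0t; rewrite /expint.
apply: (@le_trans _ _ (\int[mu]_(x in `[0%R, t]) (expR (b * q) * \1_A x))); last first.
  apply: le_Rintegral => //.
  - by apply: integrableZl_EFin => //; apply: integrable_indicS => //; exact: lt_itv_pinfty.
  - by apply: integrable_expRM; apply: integrable_indicS => //; exact: lt_itv_pinfty.
  - move=> x _; rewrite indicE; case: (boolP (x \in A)) => xA; rewrite ?mulr0// !mulr1.
    by rewrite ler_expR ler_wpM2l// qA//; exact/set_mem.
rewrite RintegralZl//; last first.
  by apply: integrable_indicS => //; exact: lt_itv_pinfty.
by rewrite /Rintegral integral_indic// setIidl.
Qed.

Lemma expint_indic0 (b t : R) A : (forall x, A x -> t < x) -> expint b \1_A t = 0.
Proof.
move=> tA; rewrite /expint (@eq_Rintegral _ _ _ _ _ (cst 0)).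
  by rewrite Rintegral_cst// mul0r.
move=> x /set_mem/=; rewrite in_itv/= => /andP[_ xt]; rewrite indicE memNset ?mulr0// => /tA.
by rewrite ltNge xt.
Qed.

Lemma expint_perturb (b c d t : R) P A B :
  mu.-integrable setT (EFin \o P) -> measurable A -> measurable B ->
  expint b (fun x => P x + (c * \1_A x - d * \1_B x)) t =
  expint b P t + (c * expint b \1_A t - d * expint b \1_B t).
Proof.
move=> iP mA mB; rewrite /expint.
have iE C : measurable C ->
    mu.-integrable `[0%R, t] (EFin \o (fun x => expR (b * x) * \1_C x)).
  by move=> mC; apply: integrable_expRM; apply: integrable_indicS => //; exact: lt_itv_pinfty.
have iZ e C : measurable C ->
    mu.-integrable `[0%R, t] (EFin \o (fun x => e * (expR (b * x) * \1_C x))).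
  move=> mC; by apply: integrableZl_EFin => //; exact: iE.
rewrite -RintegralZl//; last exact: iE.
rewrite -(RintegralZl (mu := mu) d)//; last exact: iE.
rewrite -RintegralB//; [|exact: iZ|exact: iZ].
rewrite -RintegralD//; last 2 first.
- by apply: integrable_expRM; exact: integrableS iP.
- have := @integrableB _ _ _ mu `[0%R, t] (measurable_itv _) _ _ (iZ c A mA) (iZ d B mB).
  by apply: (eq_integrable (mu := mu)).
by apply: eq_Rintegral => x _; ring.
Qed.

End Perturbation.

(** * Real-valued forms of the constraints and of the throughput *)

Section RealConstraints.
Context {R : realType}.
Notation mu := (@lebesgue_measure R).
Implicit Types (P : R -> R) (A B : set R).

Lemma EFin_Rintegral (D : set R) (f : R -> R) : measurable D ->
  mu.-integrable D (EFin \o f) ->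
  (\int[mu]_(x in D) (f x)%:E)%E = (\int[mu]_(x in D) f x)%:E.
Proof. by move=> mD if_; rewrite /Rintegral fineK//; exact: integrable_fin_num. Qed.

(** Subtract [Te], multiply by e^(bt) and divide by [a]. *)
Lemma temperature_constraintP (D a b Te Tc : R) P : 0 < a ->
  mu.-integrable `[0, D] (EFin \o P) ->
  temperature_constraint D a b Te Tc P <->
  forall t, 0 <= t <= D -> 0 <= margin b ((Tc - Te) / a) P t.
Proof.
move=> a0 iP.
suff eqv t : 0 <= t <= D ->
    (temperature a b Te P t <= Tc%:E)%E = (0 <= margin b ((Tc - Te) / a) P t).
  split=> H t; first by move=> tD; rewrite -eqv// H// in_itv.
  by rewrite in_itv/= => tD; rewrite eqv// H.
move=> /andP[t0 tD]; rewrite /temperature.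
have it : mu.-integrable `[0, t] (EFin \o P).
  by apply: integrableS iP => //; apply: subset_itvl; rewrite bnd_simp.
rewrite (_ : (\int[_]_(_ in _) _)%E = (a * expint b P t)%:E).
  rewrite -EFinM -EFinD lee_fin /margin subr_ge0 -lerBrDl.
  rewrite expRN ler_pdivrMl ?expR_gt0// -ler_pdivlMl//.
  by congr (_ <= _); rewrite [RHS]mulrC mulrCA [a^-1 * _]mulrC.
under eq_integral do rewrite -mulrA.
rewrite EFin_Rintegral//; last exact/integrableZl_EFin/integrable_expRM.
by rewrite RintegralZl//; exact: integrable_expRM.
Qed.

Lemma energy_causalityP (D : R) (N : nat) (s E : nat -> R) P :
  mu.-integrable `[0, D] (EFin \o P) ->
  energy_causality D N s E P <->
  forall t, 0 < t <= D ->
    expint 0 P t <= \sum_(0 <= i < (last_arrival N s t).+1) E i.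
Proof.
move=> iP.
suff eqv t : 0 < t <= D -> (\int[mu]_(tau in `[0%R, t]) (P tau)%:E)%E = (expint 0 P t)%:E.
  split=> H t; first by move=> tD; rewrite -lee_fin -eqv// H// in_itv.
  by rewrite in_itv/= => tD; rewrite eqv// lee_fin H.
move=> /andP[t0 tD].
have it : mu.-integrable `[0, t] (EFin \o P).
  by apply: integrableS iP => //; apply: subset_itvl; rewrite bnd_simp.
rewrite EFin_Rintegral//; congr EFin; apply: eq_Rintegral => x _.
by rewrite mul0r expR0 mul1r.
Qed.

(** The integrable bound comes from 0 <= ln(1 + P) <= P. *)
Lemma integrable_log2 (D : R) P : (forall x, 0 <= P x) ->
  mu.-integrable `[0, D] (EFin \o P) ->
  mu.-integrable `[0, D] (EFin \o (fun x => 2^-1 * log2 (1 + P x))).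
Proof.
move=> P0 iP; have /integrableP[/measurable_EFinP mP _] := iP.
apply: integrableZl_EFin => //.
have : mu.-integrable `[0, D] (EFin \o (fun x => (ln 2)^-1 * ln (1 + P x))).
  apply: integrableZl_EFin => //.
  apply: (le_integrable (mu := mu)) iP => //.
    apply/measurable_EFinP; apply: measurableT_comp; first exact: measurable_ln.
    exact: measurable_funD.
  move=> x _ /=; rewrite lee_fin ger0_norm ?ln_ge0 ?lerDl//.
  by rewrite (ger0_norm (P0 x)) le_ln1Dx// (lt_le_trans _ (P0 x))// ltrN10.
by apply: (eq_integrable (mu := mu)) => // x _; rewrite /= /log2 mulrC.
Qed.

(** Strictness is carried by a minorant [g] of the logarithmic increase; in the exchange [g] is a
    combination of two indicators, so its integral is explicit. *)
Lemma throughput_lt (D : R) P P' (g : R -> R) :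
  (forall x, 0 <= P x) -> (forall x, 0 <= P' x) ->
  mu.-integrable `[0, D] (EFin \o P) -> mu.-integrable `[0, D] (EFin \o P') ->
  mu.-integrable `[0, D] (EFin \o g) -> 0 < \int[mu]_(x in `[0, D]) g x ->
  (forall x, ln (1 + P x) + g x <= ln (1 + P' x)) ->
  (throughput D P < throughput D P')%E.
Proof.
move=> P0 P'0 iP iP' ig g0 PgP'.
have ln2 : 0 < ln 2 :> R by rewrite ln_gt0// ltr1n.
rewrite /throughput EFin_Rintegral//; last exact: integrable_log2.
rewrite EFin_Rintegral//; last exact: integrable_log2.
rewrite lte_fin.
have igc := integrableZl_EFin (2^-1 / ln 2) (measurable_itv _) ig.
have : 0 < \int[mu]_(x in `[0, D]) (2^-1 / ln 2 * g x).
  by rewrite RintegralZl// mulr_gt0// divr_gt0.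
rewrite -(ltrDl (\int[mu]_(x in `[0, D]) (2^-1 * log2 (1 + P x)))) => /lt_le_trans; apply.
rewrite -RintegralD//; last exact: integrable_log2.
apply: le_Rintegral => //.
- have := @integrableD _ _ _ mu `[0%R, D] (measurable_itv _) _ _ (integrable_log2 P0 iP) igc.
  by apply: (eq_integrable (mu := mu)).
- exact: integrable_log2.
- move=> x _; rewrite /log2 mulrA [leRHS]mulrA ![_ * _ / ln 2]mulrAC -mulrDr.
  by rewrite ler_wpM2l// divr_ge0// ltW.
Qed.

End RealConstraints.

(** * Moving energy from a late set to an early one *)

Section Exchange.
Context {R : realType}.
Notation mu := (@lebesgue_measure R).
Implicit Types (P : R -> R) (A B : set R).

Lemma integrable_indicT A : measurable A -> (mu A < +oo)%E ->
  mu.-integrable setT (EFin \o \1_A).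
Proof.
move=> mA Aoo; apply/integrableP; split.
  exact/measurable_EFinP/measurable_indic.
under eq_integral do rewrite /= ger0_norm//.
by rewrite integral_indic// setIT.
Qed.

(** Concavity of ln, with the tangent taken at the new point [z']. *)
Lemma ln_increment_ge (z z' : R) : 0 < z -> 0 < z' ->
  ln z + (z' - z) / z' <= ln z'.
Proof.
move=> z0 z'0; have zz' : 0 < z / z' by rewrite divr_gt0.
have : ln (1 + (z / z' - 1)) <= z / z' - 1 by apply: le_ln1Dx; lra.
rewrite (_ : 1 + (z / z' - 1) = z / z'); last by ring.
rewrite ln_div ?posrE//.
have -> : (z' - z) / z' = 1 - z / z' by field; rewrite gt_eqF.
by lra.
Qed.

Lemma arrival_le (N : nat) (s : nat -> R) (i j : nat) :
  (forall i, (i <= N)%N -> s i < s i.+1) ->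
  (i <= j)%N -> (j <= N.+1)%N -> s i <= s j.
Proof.
move=> hs; elim: j => [|j IH]; first by rewrite leqn0 => /eqP ->.
rewrite leq_eqVlt => /predU1P[->//|ij] jN.
by rewrite (le_trans (IH ij (ltnW jN)))// ltW// hs.
Qed.

(** The right end [s i.+1] is allowed because only arrivals strictly before [t] count. *)
Lemma last_arrivalE (N : nat) (s : nat -> R) (i : nat) (t : R) :
  (forall i, (i <= N)%N -> s i < s i.+1) -> (i <= N)%N ->
  s i < t -> t <= s i.+1 -> last_arrival N s t = i.
Proof.
move=> hs iN it ti; apply/eqP; rewrite eqn_leq; apply/andP; split.
  apply/bigmax_leqP => k kt; rewrite leqNgt; apply/negP => ik.
  have := arrival_le hs ik (ltn_ord k : k <= N.+1)%N.
  by rewrite leNgt (lt_le_trans kt ti).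
have iN2 : (i < N.+2)%N by rewrite ltnS ltnW.
exact: (@leq_bigmax_cond _ (fun k : 'I_N.+2 => s k < t) _ (Ordinal iN2)).
Qed.

(** Supplies the step size of the exchange: both changes of power stay within [h], the temporary
    excess heat within [w]. *)
Lemma small_factor (h w x y z : R) : 0 < h -> 0 < w -> 0 <= x -> 0 <= y -> 0 <= z ->
  exists2 e, 0 < e & [/\ e * x <= h, e * y <= h & e * z <= w].
Proof.
move=> h0 w0 x0 y0 z0; have S0 : 0 < 1 + x + y + z by lra.
exists (Num.min h w / (1 + x + y + z)).
  by rewrite divr_gt0// lt_min h0.
have m0 : 0 <= Num.min h w by rewrite le_min !ltW.
have key u : 0 <= u -> u <= 1 + x + y + z ->
    Num.min h w / (1 + x + y + z) * u <= Num.min h w.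
  move=> u0 uS; rewrite mulrAC ler_pdivrMr// ler_wpM2l//.
split; apply: le_trans (key _ _ _) _ => //; try lra; by rewrite ge_min lexx ?orbT.
Qed.

(* With masses [mA], [mB] of the two sets, the competitor adds [e * mB] on the early
   one and subtracts [e * mA] on the late one, so that the total energy is kept. *)
Lemma exchange (D a b Te Tc : R) (N : nat) (s E : nat -> R) P
    (i : nat) (x p q y k l w : R) :
  0 < a -> 0 < b -> s 0%N = 0 -> s N.+1 = D ->
  (forall i, (i <= N)%N -> s i < s i.+1) ->
  optimal_policy D a b Te Tc N s E P ->
  (forall x, 0 <= P x) -> mu.-integrable setT (EFin \o P) ->
  (i <= N)%N -> s i < x -> x <= p -> p <= q -> q <= y -> y < s i.+1 ->
  0 < w -> (forall t, x <= t <= y -> w <= margin b ((Tc - Te) / a) P t) ->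
  0 <= k -> k < l ->
  mu (`[x, p] `&` [set t | P t <= k]) = 0%E \/
  mu (`[q, y] `&` [set t | l <= P t]) = 0%E.
Proof.
move=> a0 b0 s0 sD hs [[_ tP eP] optP] P0 iP iN ix xp pq qy yi w0 wP k0 kl.
set A := _ `&` _; set B := (X in _ \/ mu X = _).
have /integrableP[/measurable_EFinP mP _] := iP.
have mA : measurable A by apply: measurable_fun_le => //; exact: measurable_funTS.
have mB : measurable B by apply: measurable_fun_le => //; exact: measurable_funTS.
have Aoo : (mu A < +oo)%E.
  by rewrite (le_lt_trans _ (lt_itv_pinfty x p))// le_measure// ?inE//; exact: subIsetl.
have Boo : (mu B < +oo)%E.
  by rewrite (le_lt_trans _ (lt_itv_pinfty q y))// le_measure// ?inE//; exact: subIsetl.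
have [->|A0] := eqVneq (mu A) 0%E; first by left.
have [->|B0] := eqVneq (mu B) 0%E; first by right.
exfalso.
set mA' := fine (mu A); set mB' := fine (mu B).
have mA'0 : 0 < mA' by rewrite fine_gt0// Aoo lt0e A0 measure_ge0.
have mB'0 : 0 < mB' by rewrite fine_gt0// Boo lt0e B0 measure_ge0.
have x0 : 0 < x.
  by rewrite (le_lt_trans _ ix)// -s0 (arrival_le hs)// ltnW.
have yD : y < D by rewrite (lt_le_trans yi)// -sD (arrival_le hs).
(* A third of the gap: after changes of at most [h], values up to [k + h] on [A] and from [l - h] on
   [B] are still separated. *)
pose h := (l - k) / 3.
have h0 : 0 < h by rewrite /h; lra.
have [e e0 [eA eB eW]] := small_factor h0 w0 (ltW mA'0) (ltW mB'0)
  (mulr_ge0 (mulr_ge0 (expR_ge0 (b * p)) (ltW mA'0)) (ltW mB'0)).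
pose c := e * mB'; pose d := e * mA'.
have c0 : 0 < c by rewrite mulr_gt0.
have d0 : 0 < d by rewrite mulr_gt0.
pose P' z := P z + (c * \1_A z - d * \1_B z).
have P'A z : A z -> P z <= k /\ P' z = P z + c.
  move=> Az; have Pk : P z <= k by case: Az.
  rewrite /P' !indicE mem_set// memNset ?mulr0 ?mulr1 ?subr0// => -[_ /=].
  by rewrite leNgt (le_lt_trans Pk kl).
have P'B z : B z -> l <= P z /\ P' z = P z - d.
  move=> Bz; have Pl : l <= P z by case: Bz.
  rewrite /P' !indicE (mem_set Bz) memNset ?mulr0 ?mulr1 ?sub0r// => -[_ /=].
  by rewrite leNgt (lt_le_trans kl Pl).
have P'N z : ~ A z -> ~ B z -> P' z = P z.
  by move=> Az Bz; rewrite /P' !indicE !memNset// !mulr0 subr0 addr0.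
have P'0 z : 0 <= P' z.
  have [/P'A[_ ->]|Az] := pselect (A z); first by rewrite addr_ge0// ltW.
  have [/P'B[lz ->]|Bz] := pselect (B z); last by rewrite P'N.
  by move: eA; rewrite -/d /h => eA; lra.
have iA := integrable_indicT mA Aoo; have iB := integrable_indicT mB Boo.
have igAB u v : mu.-integrable setT (EFin \o (fun z => u * \1_A z - v * \1_B z)).
  have := @integrableB _ _ _ mu setT measurableT _ _
    (integrableZl_EFin u measurableT iA) (integrableZl_EFin v measurableT iB).
  by apply: (eq_integrable (mu := mu)).
have iP' : mu.-integrable setT (EFin \o P').
  have := @integrableD _ _ _ mu setT measurableT _ _ iP (igAB c d).
  by apply: (eq_integrable (mu := mu)).
have iS f (u v : R) : mu.-integrable setT (EFin \o f) -> mu.-integrable `[u, v] (EFin \o f).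
  by apply: integrableS.
have Ap z : A z -> x <= z <= p by case => /=; rewrite in_itv.
have Bq z : B z -> q <= z <= y by case => /=; rewrite in_itv.
have before b' t : t < x -> expint b' P' t = expint b' P t.
  move=> tx; rewrite expint_perturb// !expint_indic0 ?mulr0 ?subr0 ?addr0//.
  - by move=> z /Bq/andP[qz _]; rewrite (lt_le_trans tx)// (le_trans _ qz)// (le_trans xp).
  - by move=> z /Ap/andP[xz _]; exact: lt_le_trans xz.
have gain b' t : 0 <= b' -> c * expint b' \1_A t <= e * (expR (b' * p) * mA' * mB').
  move=> b'0; rewrite /c -mulrA ler_pM2l// mulrC ler_pM2r//.
  by apply: expint_indic_le => // z /Ap/andP[].
have after b' t : 0 <= b' -> y <= t -> expint b' P' t <= expint b' P t.
  move=> b'0 yt; rewrite expint_perturb// gerDl subr_le0 (le_trans (gain _ _ b'0))//.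
  (* The removal on [B] outweighs the addition on [A], since c mA' = d mB' and e^(b'p) <= e^(b'q).
     Taking [b' = 0] covers the energy. *)
  apply: (@le_trans _ _ (d * (expR (b' * q) * mB'))).
    rewrite /d -!mulrA ler_pM2l// mulrCA ler_pM2l// ler_pM2r// ler_expR.
    by rewrite ler_wpM2l.
  rewrite ler_pM2l// expint_indic_ge//; first by move=> z /Bq/andP[].
  move=> z /Bq/andP[qz zy] /=; rewrite in_itv/= (le_trans zy yt) andbT.
  by rewrite (le_trans (ltW x0))// (le_trans xp)// (le_trans pq).
have feasP' : feasible_policy D a b Te Tc N s E P'.
  have /integrableP[/measurable_EFinP mP' _] := iP'.
  split; first by split => [|z _]; [exact: measurable_funTS|exact: P'0].
  - apply/temperature_constraintP => //; first exact: iS.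
    move=> t /andP[t0 tD].
    have /temperature_constraintP-/(_ a0 (iS _ _ _ iP) t) := tP.
    rewrite t0 tD => /(_ isT); rewrite /margin.
    have [tx|xt] := ltP t x; first by rewrite before.
    have [ty|yt] := ltP t y; last by have := after _ _ (ltW b0) yt; lra.
    (* Between [x] and [y] the heat may grow, but by at most [w], which the margin absorbs. *)
    move=> _; have := wP t; rewrite xt (ltW ty) => /(_ isT).
    rewrite expint_perturb// /margin; have := gain b t (ltW b0).
    have : 0 <= d * expint b \1_B t by rewrite mulr_ge0 ?(ltW d0)// expint_ge0.
    by lra.
  - apply/energy_causalityP; first exact: iS.
    move=> t /andP[t0 tD].
    have /energy_causalityP-/(_ (iS _ _ _ iP)) eP' := eP.
    have [tx|xt] := ltP t x; first by rewrite before// eP'// t0.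
    have [ty|yt] := ltP t y; last by rewrite (le_trans (after _ _ _ yt))// eP'// t0.
    have it : s i < t by exact: lt_le_trans xt.
    rewrite (last_arrivalE hs iN)//; last by rewrite ltW// (lt_trans ty).
    (* The energy spent by [t] is at most that spent by [y], and both times have the same energy
       budget. *)
    rewrite (le_trans (le_expint 0 P'0 iP' (ltW t0) (ltW ty)))//.
    rewrite (le_trans (after _ _ _ (lexx y)))//.
    have := eP' y; rewrite (lt_trans t0 ty) ltW// => /(_ isT).
    by rewrite (last_arrivalE hs iN (lt_trans it ty))// ltW.
have := optP _ feasP'; apply/negP; rewrite -ltNge.
(* Slopes of ln(1 + .) at the power levels [k + h] and [l - h]: at the new values the slope is at
   least [u] on [A] and at most [v] on [B]. *)
pose u := (1 + k + h)^-1; pose v := (1 + l - h)^-1.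
have uv : v < u by rewrite ltf_pV2 ?posrE /h; clear -k0 kl; lra.
apply: (@throughput_lt _ _ _ _ (fun z => (c * u) * \1_A z - (d * v) * \1_B z)) => //;
  [exact: iS|exact: iS|exact: iS| |].
- rewrite RintegralB//; last 2 first.
  + by apply: integrableZl_EFin => //; exact: iS.
  + by apply: integrableZl_EFin => //; exact: iS.
  rewrite RintegralZl//; last exact: iS.
  rewrite RintegralZl//; last exact: iS.
  rewrite /Rintegral !integral_indic// !setIidl; last 2 first.
  + move=> z /Bq/andP[qz zy] /=; rewrite in_itv/=; clear -x0 xp pq qz zy yD.
    by apply/andP; split; lra.
  + move=> z /Ap/andP[xz zp] /=; rewrite in_itv/=; clear -x0 xz zp pq qy yD.
    by apply/andP; split; lra.
  rewrite -/mA' -/mB' (_ : _ - _ = e * mA' * mB' * (u - v)); last by rewrite /c /d; ring.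
  by rewrite mulr_gt0 ?subr_gt0// !mulr_gt0.
- move=> z.
  have Pz : 0 < 1 + P z by rewrite ltr_wpDr.
  have P'z : 0 < 1 + P' z by rewrite ltr_wpDr.
  apply: le_trans (ln_increment_ge Pz P'z); rewrite lerD2l.
  have [Az|Az] := pselect (A z).
    have [Pk E'] := P'A _ Az; have Bz : ~ B z by move=> /P'B[]; lra.
    rewrite !indicE (mem_set Az) (memNset Bz) mulr0 mulr1 subr0 E'.
    rewrite (_ : _ - _ = c); last by ring.
    rewrite ler_pM2l// lef_pV2 ?posrE -?E'//; last by rewrite /h; lra.
    by rewrite E'; move: eB; rewrite -/c; lra.
  have [Bz|Bz] := pselect (B z).
    have [Pl E'] := P'B _ Bz.
    rewrite !indicE (mem_set Bz) (memNset Az) mulr0 mulr1 sub0r E'.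
    rewrite (_ : _ - _ = - d); last by ring.
    rewrite mulNr lerN2 ler_pM2l// lef_pV2 ?posrE -?E'//; last by rewrite /h; lra.
    by rewrite E'; move: eA; rewrite -/d; lra.
  by rewrite P'N// subrr mul0r !indicE !memNset// !mulr0 subr0.
Qed.

End Exchange.

(** * Local increase, and first and last nonpositive times *)

Section RealFunctions.
Context {R : realType}.
Implicit Types f : R -> R.

(** One [e] serves both sides, as the difference quotient is positive on a punctured
    neighbourhood. *)
Lemma derive_gt0_increase f (t d h : R) : is_derive t 1 f d -> 0 < d -> 0 < h ->
  exists2 e, 0 < e < h & f (t - e) < f t < f (t + e).
Proof.
move=> [df <-] d0 h0.
have : h^-1 *: (f (h *: 1 + t) - f t) @[h --> 0^'] --> 'D_1 f t by exact: df.
move=> /cvgr_gt /(_ 0 d0)/= [r /= r0 hr].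
pose e := Num.min r h / 2.
have m0 : 0 < Num.min r h by rewrite lt_min r0.
have e0 : 0 < e by rewrite divr_gt0.
have er : e < r by rewrite /e ltr_pdivrMr// gt_min; apply/orP; left; lra.
have eh : e < h by rewrite /e ltr_pdivrMr// gt_min; apply/orP; right; lra.
exists e; first by rewrite e0.
apply/andP; split.
- have := hr (- e); rewrite /= sub0r opprK gtr0_norm// oppr_eq0 gt_eqF// => /(_ er isT).
  by rewrite invrN scaleNr -scalerN opprB /GRing.scale/= pmulr_rgt0 ?invr_gt0//
    subr_gt0 mulr1 addrC.
- have := hr e; rewrite /= sub0r normrN gtr0_norm// gt_eqF// => /(_ er isT).
  by rewrite /GRing.scale/= pmulr_rgt0 ?invr_gt0// subr_gt0 mulr1 addrC.
Qed.

Lemma continuous_lt_near f (t c h : R) : {for t, continuous f} -> f t < c -> 0 < h ->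
  exists2 e, 0 < e < h & f (t - e) < c /\ f (t + e) < c.
Proof.
move=> cf ft h0; have : \forall u \near t, f u < c by exact: (cvgr_lt _ cf).
move=> [r /= r0 hr]; pose e := Num.min r h / 2.
have m0 : 0 < Num.min r h by rewrite lt_min r0.
have e0 : 0 < e by rewrite divr_gt0.
have er : e < r by rewrite /e ltr_pdivrMr// gt_min; apply/orP; left; lra.
have eh : e < h by rewrite /e ltr_pdivrMr// gt_min; apply/orP; right; lra.
exists e; first by rewrite e0.
split; apply: hr => /=.
- by rewrite opprB addrC subrK gtr0_norm.
- by rewrite opprD addNKr normrN gtr0_norm.
Qed.

Lemma compact_nonpos f (x z : R) : {in `[x, z], continuous f} ->
  compact (`[x, z] `&` [set t | f t <= 0]).
Proof.
move=> cf; apply: subclosed_compact (@segment_compact _ x z) _; last exact: subIsetl.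
move=> t clt; have txz : `[x, z]%classic t.
  by apply: itv_closed; have /closureI[] := clt.
split => //=; rewrite leNgt; apply/negP => ft.
have /clt[u [[_ /=]]] : nbhs t [set u | 0 < f u] by exact: (cvgr_gt _ (cf _ txz) 0 ft).
by rewrite leNgt => /negP.
Qed.

(** The nonpositive times form a nonempty compact set, on which the identity attains its minimum. *)
Lemma first_nonpos f (x z : R) : {in `[x, z], continuous f} -> x <= z -> f z <= 0 ->
  exists2 u, x <= u <= z & f u <= 0 /\ forall t, x <= t < u -> 0 < f t.
Proof.
move=> cf xz fz.
have S0 : (`[x, z] `&` [set t | f t <= 0]) !=set0.
  by exists z; split => //=; rewrite in_itv/= xz lexx.
have [u /set_mem[/= uxz fu] umin] := compact_EVT_min S0 (compact_nonpos cf)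
  (continuous_subspaceT (fun=> cvg_id)).
rewrite in_itv/= in uxz; exists u => //; split => // t /andP[xt tu].
rewrite ltNge; apply/negP => ft.
have := umin t; rewrite leNgt tu => H; apply/not_false_is_true/H/mem_set; split => //=.
by rewrite in_itv/= xt (le_trans (ltW tu))//; case/andP: uxz.
Qed.

Lemma last_nonpos f (x z : R) : {in `[x, z], continuous f} -> x <= z -> f x <= 0 ->
  exists2 u, x <= u <= z & f u <= 0 /\ forall t, u < t <= z -> 0 < f t.
Proof.
move=> cf xz fx.
have S0 : (`[x, z] `&` [set t | f t <= 0]) !=set0.
  by exists x; split => //=; rewrite in_itv/= xz lexx.
have [u /set_mem[/= uxz fu] umax] := compact_EVT_max S0 (compact_nonpos cf)
  (continuous_subspaceT (fun=> cvg_id)).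
rewrite in_itv/= in uxz; exists u => //; split => // t /andP[ut tz].
rewrite ltNge; apply/negP => ft.
have := umax t; rewrite leNgt ut => H; apply/not_false_is_true/H/mem_set; split => //=.
by rewrite in_itv/= tz andbT (le_trans _ (ltW ut))//; case/andP: uxz.
Qed.

End RealFunctions.

(** * The derivative of the margin *)

Section Margin.
Context {R : realType}.
Notation mu := (@lebesgue_measure R).
Implicit Types (P : R -> R).

(** The times at which the value of [P] is recovered from its integral; values of [P] are compared
    only at such times. *)
Definition regular_time (b : R) P (t : R) : Prop :=
  is_derive t 1 (expint b P) (expR (b * t) * P t).

(** Lebesgue differentiation; [0 < t] because the integral starts at 0. *)
Lemma ae_regular_time (b D : R) P : mu.-integrable setT (EFin \o P) ->
  (forall x, ~ `[0, D]%classic x -> P x = 0) ->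
  {ae mu, forall t, 0 < t -> regular_time b P t}.
Proof.
move=> iP P0.
have iE := integrable_expRM_supp b iP P0.
have locE := open_integrable_locally openT iE.
have iEy y : mu.-integrable [set` Interval (BLeft 0) (BRight y)]
    (EFin \o (fun x => expR (b * x) * P x)).
  by apply: integrableS iE.
have := FTC1 iEy locE.
apply: filterS; first exact: (ae_filter_ringOfSetsType mu).
move=> t /= Ht t0; have [|dE E'] := Ht; first by rewrite lte_fin.
apply: DeriveDef; [exact: dE|rewrite -derive1E; exact: E'].
Qed.

Lemma is_derive_margin (b k t : R) P : regular_time b P t ->
  is_derive t 1 (margin b k P) (expR (b * t) * (b * k - P t)).
Proof.
move=> rt; rewrite mulrBr.
exact: (is_deriveB (is_derive_expRM b k t) rt).
Qed.

(** Together with [margin_lt_level], this turns a low value at one regular time into a non-null set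
    of low values just after it; [margin_fall] likewise gives high values just before. *)
Lemma margin_rise (b k t h : R) P : regular_time b P t -> P t < b * k -> 0 < h ->
  exists2 p, t < p < t + h & margin b k P t < margin b k P p.
Proof.
move=> rt Pt h0.
have [|e /andP[e0 eh] /andP[_ te]] :=
    derive_gt0_increase (is_derive_margin k rt) _ h0.
  by rewrite pmulr_rgt0 ?expR_gt0// subr_gt0.
by exists (t + e) => //; rewrite ltrDl e0 ltrD2l.
Qed.

Lemma margin_fall (b k t h : R) P : regular_time b P t -> b * k < P t -> 0 < h ->
  exists2 q, t - h < q < t & margin b k P t < margin b k P q.
Proof.
move=> rt Pt h0.
have [|e /andP[e0 eh] /andP[+ _]] :=
    derive_gt0_increase (is_deriveN (is_derive_margin k rt)) _ h0.
  by rewrite oppr_gt0 pmulr_rlt0 ?expR_gt0// subr_lt0.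
change (- margin b k P (t - e) < - margin b k P t ->
  exists2 q, t - h < q < t & margin b k P t < margin b k P q).
rewrite ltrN2 => te; exists (t - e) => //.
by rewrite ltrD2l ltrN2 eh gtrBl.
Qed.

Lemma continuous_margin (b k t : R) P : mu.-integrable setT (EFin \o P) ->
  0 < t -> {for t, continuous (margin b k P)}.
Proof.
move=> iP t0; apply: cvgB; first exact: continuous_expRM.
have t1 : 0 < t + 1 by rewrite addr_gt0.
apply: (within_continuous_continuous t1); last by rewrite in_itv/= t0 ltrDl ltr01.
apply: parameterized_integral_continuous; first exact: ltW.
by apply: integrable_expRM; exact: integrableS iP.
Qed.

(** An interior minimum of the margin, so its derivative vanishes. *)
Lemma regular_margin0 (b k t h : R) P : regular_time b P t -> 0 < h ->
  (forall u, t - h < u < t + h -> 0 <= margin b k P u) -> margin b k P t = 0 ->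
  P t = b * k.
Proof.
move=> rt h0 m0 mt; apply/eqP; rewrite eq_le; apply/andP; split;
  rewrite leNgt; apply/negP => Pt.
- have dm := is_deriveN (is_derive_margin k rt).
  have [||e /andP[e0 et] /andP[_]] := @derive_gt0_increase _ _ t _ h dm => //.
    by rewrite oppr_gt0 pmulr_rlt0 ?expR_gt0// subr_lt0.
  change (- margin b k P t < - margin b k P (t + e) -> False).
  by rewrite mt oppr0 oppr_gt0 ltNge m0//; apply/andP; split; lra.
- have dm := is_derive_margin k rt.
  have [||e /andP[e0 et] /andP[+ _]] := @derive_gt0_increase _ _ t _ h dm => //.
    by rewrite pmulr_rgt0 ?expR_gt0// subr_gt0.
  by rewrite mt ltNge m0//; apply/andP; split; lra.
Qed.

End Margin.

(** * Monotonicity along regular times of an epoch *)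

Section Monotone.
Context {R : realType}.
Notation mu := (@lebesgue_measure R).
Context (D a b Te Tc : R) (N : nat) (s E : nat -> R) (P : R -> R).
Context (a0 : 0 < a) (b0 : 0 < b) (TT : Te < Tc) (s0 : s 0%N = 0) (sD : s N.+1 = D).
Context (hs : forall i, (i <= N)%N -> s i < s i.+1).
Context (optP : optimal_policy D a b Te Tc N s E P).
Context (P0 : forall x, 0 <= P x) (iP : mu.-integrable setT (EFin \o P)).
Let K := (Tc - Te) / a.

Lemma arrival_bounds (i : nat) (t : R) : (i <= N)%N -> s i < t -> t < s i.+1 -> 0 < t < D.
Proof.
move=> iN it ti; rewrite (le_lt_trans _ it)/=; last first.
  by rewrite -s0 (arrival_le hs)// ltnW.
by rewrite (lt_le_trans ti)// -sD (arrival_le hs).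
Qed.

(** The exchange in terms of margins: the rise over [x, p] makes the low set non-null, the fall over
    [q, y] the high one. Compactness of [x, y] turns positivity of the true margin into a uniform
    bound. *)
Lemma no_late_rise (i : nat) (x p q y k l : R) : (i <= N)%N ->
  s i < x -> x < p -> p <= q -> q < y -> y < s i.+1 ->
  (forall t, x <= t <= y -> 0 < margin b K P t) -> 0 <= b * k -> k < l ->
  margin b k P x < margin b k P p -> margin b l P y < margin b l P q -> False.
Proof.
move=> iN ix xp pq qy yi m0 k0 kl kxp lqy.
have xy : x < y by rewrite (lt_le_trans xp)// (le_trans pq)// ltW.
have /andP[x0 _] := arrival_bounds iN ix (lt_trans xy yi).
have [w0 wP] : exists2 w, 0 < w & forall t, x <= t <= y -> w <= margin b K P t.
  have [|w wxy wmin] := @EVT_min R (margin b K P) x y (ltW xy).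
    apply: continuous_in_subspaceT => t /set_mem/=; rewrite in_itv/= => /andP[xt _].
    by apply: continuous_margin => //; exact: lt_le_trans xt.
  exists (margin b K P w); first by apply: m0; rewrite in_itv/= in wxy.
  by move=> t txy; apply: wmin; rewrite in_itv.
move=> wP'.
have /eqP := margin_lt_level (ltW x0) xp iP kxp.
have q0 : 0 <= q by rewrite (le_trans (ltW x0))// (le_trans (ltW xp)).
have /eqP := margin_gt_level q0 qy iP lqy.
have bkl : b * k < b * l by rewrite ltr_pM2l.
have [->//|->//] := exchange a0 b0 s0 sD hs optP P0 iP iN ix (ltW xp) pq (ltW qy) yi wP wP' k0 bkl.
Qed.

Lemma regular_nonincreasing (i : nat) (t1 t2 : R) : (i <= N)%N ->
  s i < t1 -> t1 < t2 -> t2 < s i.+1 ->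
  regular_time b P t1 -> regular_time b P t2 -> P t2 <= P t1.
Proof.
move=> iN it1 t12 t2i r1 r2; rewrite leNgt; apply/negP => P12.
have /andP[t10 t1D] := arrival_bounds iN it1 (lt_trans t12 t2i).
have /andP[t20 t2D] := arrival_bounds iN (lt_trans it1 t12) t2i.
have mge0 t : 0 <= t <= D -> 0 <= margin b K P t.
  case: optP => -[_ /temperature_constraintP-/(_ a0) tP _] _.
  by apply: tP; exact: integrableS iP.
have cm u v : 0 < u -> {in `[u, v], continuous (margin b K P)}.
  move=> u0 t; rewrite in_itv/= => /andP[ut _].
  by apply: continuous_margin => //; exact: lt_le_trans ut.
have mgt0 t : 0 < t < D -> regular_time b P t -> P t != b * K -> 0 < margin b K P t.
  move=> /andP[t0 tD] rt Pt; rewrite lt_neqAle mge0 ?(ltW t0) ?(ltW tD)// andbT eq_sym.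
  have h0 : 0 < Num.min t (D - t) by rewrite lt_min t0 subr_gt0.
  apply: contra_neq Pt => mt; apply: (regular_margin0 rt h0 _ mt) => v /andP[].
  rewrite ltrBlDr -ltrBlDl -ltrBlDl !lt_min => /andP[tv _] /andP[_ vt].
  by apply: mge0; apply/andP; split; lra.
(* To test [P] against the power [v], the margin parameter is [v / b]. *)
have Kb v : b * (v / b) = v by rewrite mulrC divfK// gt_eqF.
have [[u /andP[t1u ut2] mu0]|mpos] :=
    pselect (exists2 u, t1 <= u <= t2 & margin b K P u <= 0); last first.
  (* No zero on [t1, t2]. The levels lie one third and two thirds of the way from [P t1] to [P t2],
     and half of the time span on each side ensures [p <= q]. *)
  have [||p /andP[t1p pt] kp] := @margin_rise _ b
    (((2 * P t1 + P t2) / 3) / b) _ ((t2 - t1) / 2) _ r1.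
  - by rewrite Kb; lra.
  - by lra.
  have [||q /andP[tq qt2] lq] := @margin_fall _ b
    (((P t1 + 2 * P t2) / 3) / b) _ ((t2 - t1) / 2) _ r2.
  - by rewrite Kb; lra.
  - by lra.
  apply: (no_late_rise iN it1 t1p _ qt2 t2i _ _ _ kp lq); first lra.
  - move=> t t12'; rewrite ltNge; apply/negP => mt; apply: mpos; by exists t.
  - by rewrite Kb; have := P0 t1; have := P0 t2; lra.
  - by rewrite ltr_pM2r ?invr_gt0//; lra.
have u0 : 0 < u by exact: lt_le_trans t1u.
have [P1c|P1c] := ltP (P t1) (b * K).
- have m1 : 0 < margin b K P t1 by apply: mgt0; rewrite ?t10// lt_eqF.
  have [v /andP[t1v vu] [mv vpos]] := first_nonpos (cm _ _ t10) t1u mu0.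
  have {}t1v : t1 < v.
    by rewrite lt_neqAle t1v andbT; apply: contraTneq m1 => ->; rewrite -leNgt.
  (* The margin is positive at [m] and at most 0 at [v], so by continuity it has dropped below its
     value at [m] at some [v - e] before the zero. The low level is midway between [P t1] and
     [b * K], the high one is [b * K]. *)
  pose m := (t1 + v) / 2.
  have [t1m mv'] : t1 < m /\ m < v by rewrite /m; split; lra.
  have mm : 0 < margin b K P m by apply: vpos; rewrite (ltW t1m).
  have cv := @continuous_margin _ b K v P iP (lt_trans t10 t1v).
  have [||e /andP[e0 em] [me _]] := @continuous_lt_near _ _ _ (margin b K P m) (v - m) cv.
  + exact: le_lt_trans mm.
  + by rewrite subr_gt0.
  have [||p /andP[t1p pm] kp] := @margin_rise _ b (((P t1 + b * K) / 2) / b) _ (m - t1) _ r1.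
  + by rewrite Kb; lra.
  + by rewrite subr_gt0.
  apply: (no_late_rise iN it1 t1p _ _ _ _ _ _ kp me).
  + by move: pm; rewrite addrC subrK => /ltW.
  + by rewrite ltrBrDr -ltrBrDl.
  + rewrite ltrBlDr (le_lt_trans vu)// (le_lt_trans ut2)// (lt_trans t2i)//.
    by rewrite ltrDl.
  + by move=> t /andP[t1t tv]; apply: vpos; rewrite t1t/= (le_lt_trans tv)// gtrBl.
  + by rewrite Kb; have := P0 t1; lra.
  + by rewrite ltr_pdivrMr// [K * b]mulrC; lra.
- have P2c : b * K < P t2 by exact: le_lt_trans P12.
  have m2 : 0 < margin b K P t2 by apply: mgt0; rewrite ?t20// gt_eqF.
  have [v /andP[uv vt2] [mv vpos]] := last_nonpos (cm _ _ u0) ut2 mu0.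
  have {}vt2 : v < t2.
    by rewrite lt_neqAle vt2 andbT; apply: contraTneq m2 => <-; rewrite -leNgt.
  (* Symmetrically, the margin rises from [v + e] to [m] after the last zero; now [b * K] is the low
     level. *)
  pose m := (v + t2) / 2.
  have [vm mt2] : v < m /\ m < t2 by rewrite /m; split; lra.
  have mm : 0 < margin b K P m by apply: vpos; rewrite vm ltW.
  have cv := @continuous_margin _ b K v P iP (lt_le_trans u0 uv).
  have [||e /andP[e0 em] [_ me]] := @continuous_lt_near _ _ _ (margin b K P m) (m - v) cv.
  + exact: le_lt_trans mm.
  + by rewrite subr_gt0.
  have [||q /andP[mq qt2] lq] := @margin_fall _ b (((P t2 + b * K) / 2) / b) _ (t2 - m) _ r2.
  + by rewrite Kb; lra.
  + by rewrite subr_gt0.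
  apply: (no_late_rise iN _ _ _ qt2 t2i _ _ _ me lq).
  + by rewrite (lt_le_trans it1)// (le_trans t1u)// (le_trans uv)// lerDl ltW.
  + by rewrite -ltrBrDl.
  + by move: mq; rewrite subKr => /ltW.
  + by move=> t /andP[vt tt2]; apply: vpos; rewrite tt2 andbT (lt_le_trans _ vt)// ltrDl.
  + by rewrite mulr_ge0 ?ltW// divr_gt0// subr_gt0.
  + by rewrite ltr_pdivlMr// [K * b]mulrC; lra.
Qed.
End Monotone.

(** * A monotone modification *)

Lemma nonincreasing_in_measurable (R : realType) (u v : R) (f : R -> R) :
  {in `]u, v[ &, nonincreasing_fun f} -> measurable_fun `]u, v[ f.
Proof.
move=> f_ni; apply: (measurability (@RGenCInfty.G R)) => [|/= _ [_] [r] -> <-].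
  exact: RGenCInfty.measurableE.
(* Monotonicity makes the preimage of [r, +oo[ an interval. *)
apply: is_interval_measurable => x y /= [xuv fx] [yuv fy] z /andP[xz zy].
have zuv : z \in `]u, v[.
  move: xuv yuv; rewrite !in_itv/= => /andP[ux _] /andP[_ yv].
  by rewrite (lt_le_trans ux xz) (le_lt_trans zy yv).
split => //; move: fy; rewrite /= !in_itv/= !andbT => /le_trans; apply.
exact: f_ni.
Qed.

Section Modification.
Context {R : realType}.
Notation mu := (@lebesgue_measure R).
Context (D a b Te Tc : R) (N : nat) (s E : nat -> R) (P : R -> R).
Context (a0 : 0 < a) (b0 : 0 < b) (TT : Te < Tc) (s0 : s 0%N = 0) (sD : s N.+1 = D).
Context (hs : forall i, (i <= N)%N -> s i < s i.+1).
Context (optP : optimal_policy D a b Te Tc N s E P).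
Context (P0 : forall x, 0 <= P x) (iP : mu.-integrable setT (EFin \o P)).
Context (regP : {ae mu, forall t, 0 < t -> regular_time b P t}).

Lemma regular_time_between (u v : R) : 0 <= u -> u < v ->
  exists2 g, u < g < v & regular_time b P g.
Proof.
move=> u0 uv; apply: contrapT => nreg.
have : mu.-negligible `]u, v[.
  apply: negligibleS regP => g /=; rewrite in_itv/= => guv reg.
  apply: nreg; exists g => //; apply: reg.
  by case/andP: guv => ug _; exact: le_lt_trans ug.
move=> /measure_negligible-/(_ (measurable_itv _)).
rewrite /= lebesgue_measure_itv/= lte_fin uv => /eqP.
by rewrite -EFinB eqe subr_eq0 gt_eqF.
Qed.

(* [regular_time_between] and the bound at an earlier regular time make the set
   below nonempty and bounded inside an epoch, so [sup] is not a junk value there. *)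
Definition later_values (i : nat) (t : R) : set R :=
  [set P g | g in [set g | regular_time b P g /\ t <= g < s i.+1]].

(** At [t = s j] with 0 < j <= N + 1 the last arrival strictly before [t] is [j - 1], so the test
    fails and the value of [P] is kept. *)
Definition monotone_version (t : R) : R :=
  let i := last_arrival N s t in
  if s i < t < s i.+1 then sup (later_values i t) else P t.

Lemma monotone_versionE (i : nat) (t : R) : (i <= N)%N -> s i < t < s i.+1 ->
  monotone_version t = sup (later_values i t).
Proof.
move=> iN /andP[it ti]; rewrite /monotone_version.
by rewrite (last_arrivalE hs iN it (ltW ti)) it ti.
Qed.

Lemma has_sup_later_values (i : nat) (t : R) : (i <= N)%N -> s i < t < s i.+1 ->
  has_sup (later_values i t).
Proof.
move=> iN /andP[it ti]; have /andP[t0 tD] := arrival_bounds s0 sD hs iN it ti.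
split.
  have [g /andP[tg gi] rg] := regular_time_between (ltW t0) ti.
  by exists (P g), g => //; split => //; rewrite (ltW tg).
have si0 : 0 <= s i by rewrite -s0 (arrival_le hs)// ltnW.
have [g /andP[ig gt] rg] := regular_time_between si0 it.
exists (P g) => _ [g' [rg' /andP[tg' g'i]] <-].
apply: (regular_nonincreasing a0 b0 TT s0 sD hs optP P0 iP iN ig _ g'i rg rg').
exact: lt_le_trans tg'.
Qed.

(** At a regular time [P t] is itself one of the later values, and the largest. *)
Lemma monotone_version_regular (i : nat) (t : R) : (i <= N)%N -> s i < t < s i.+1 ->
  regular_time b P t -> monotone_version t = P t.
Proof.
move=> iN iti rt; rewrite (monotone_versionE iN iti).
have hsup := has_sup_later_values iN iti.
have /andP[it ti] := iti.
have Pt : later_values i t (P t) by exists t => //; split => //; rewrite lexx.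
apply/eqP; rewrite eq_le sup_upper_bound// andbT.
apply: ge_sup; first by exists (P t).
move=> _ [g [rg /andP[tg gi]] <-]; have [->//|ntg] := eqVneq g t.
have {}tg : t < g by rewrite lt_neqAle eq_sym ntg.
exact: (regular_nonincreasing a0 b0 TT s0 sD hs optP P0 iP iN it tg gi rt rg).
Qed.

(** The sets of later values shrink as time grows. *)
Lemma monotone_version_nonincreasing (i : nat) : (i <= N)%N ->
  {in `]s i, s i.+1[ &, nonincreasing_fun monotone_version}.
Proof.
move=> iN t u; rewrite !in_itv/= => it iu tu.
rewrite (monotone_versionE iN it) (monotone_versionE iN iu).
have hu := has_sup_later_values iN iu.
apply: sup_le; [|exact: hu.1|exact: has_sup_later_values].
move=> _ [g [rg /andP[ug gi]] <-]; apply/downP; exists (P g) => //.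
by exists g => //; split => //; rewrite (le_trans tu).
Qed.

(** The bound by [D] matters: beyond it the last arrival is [N.+1], and the test would involve the
    unconstrained [s N.+2]. *)
Lemma epoch_or_eq (t : R) : 0 <= t <= D ->
  (exists2 i, (i <= N)%N & s i < t < s i.+1) \/ monotone_version t = P t.
Proof.
move=> /andP[t0 tD]; rewrite /monotone_version; case: ifPn => [iti|]; last by right.
left; exists (last_arrival N s t) => //; rewrite leqNgt; apply/negP => Ni.
have iN : (last_arrival N s t <= N.+1)%N.
  by apply/bigmax_leqP => k _; rewrite -ltnS.
have e : last_arrival N s t = N.+1 by apply/eqP; rewrite eqn_leq iN.
by move: iti; rewrite e sD ltNge tD.
Qed.

Lemma monotone_version_ge0 (t : R) : 0 <= t <= D -> 0 <= monotone_version t.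
Proof.
move=> /epoch_or_eq[[i iN iti]|->//]; rewrite (monotone_versionE iN iti).
have hsup := has_sup_later_values iN iti.
have [_ [g Sg _]] := hsup.1.
rewrite (le_trans (P0 g))// sup_upper_bound//.
by exists g.
Qed.

Lemma ae_monotone_version :
  {ae mu, forall t, t \in `[0, D] -> monotone_version t = P t}.
Proof.
apply: filterS regP; first exact: (ae_filter_ringOfSetsType mu).
move=> t reg; rewrite in_itv/= => tD; have [[i iN iti]|//] := epoch_or_eq tD.
apply: (monotone_version_regular iN iti); apply: reg.
by have /andP[it ti] := iti; have /andP[] := arrival_bounds s0 sD hs iN it ti.
Qed.

Lemma measurable_monotone_version : measurable_fun `[0, D] monotone_version.
Proof.
rewrite -sD.
(* Induction over epochs: each step glues on an open epoch and its end point. *)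
suff H n : (n <= N.+1)%N -> measurable_fun `[0, s n] monotone_version by exact: H.
elim: n => [_|n IH nN].
  by rewrite s0 set_itv1; exact: measurable_fun_set1.
have -> : `[0, s n.+1]%classic = (`[0, s n] `|` `]s n, s n.+1[ `|` [set s n.+1])%classic.
  have sn0 : 0 <= s n by rewrite -s0 (arrival_le hs)// ltnW.
  have snn := hs nN.
  apply/seteqP; split => t /=; rewrite !in_itv/=.
  - move=> /andP[t0]; rewrite le_eqVlt => /orP[/eqP->|tn]; first by right.
    by left; have [tn'|nt] := leP t (s n); [left; rewrite t0|right].
  - move=> [[/andP[t0 tn]|/andP[nt tn]]|->].
    + by rewrite t0 (le_trans tn)// ltW.
    + by rewrite (le_trans sn0 (ltW nt)) ltW.
    + by rewrite lexx andbT (le_trans sn0)// ltW.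
apply/measurable_funU => //; first exact: measurableU.
split; last exact: measurable_fun_set1.
apply/measurable_funU => //; split; first by apply: IH; exact: ltnW.
apply: nonincreasing_in_measurable; exact: monotone_version_nonincreasing.
Qed.

End Modification.

(** * Optimality under modification on a null set *)

Section AlmostEverywhere.
Context {R : realType}.
Notation mu := (@lebesgue_measure R).

(** Both constraints and the objective see the policy only through integrals. Its sign is a
    pointwise condition, hence the assumption on [Q]. *)
Lemma optimal_policy_ae (D a b Te Tc : R) (N : nat) (s E : nat -> R) (P Q : R -> R) :
  {ae mu, forall t, t \in `[0, D] -> Q t = P t} -> power_policy D Q ->
  optimal_policy D a b Te Tc N s E P -> optimal_policy D a b Te Tc N s E Q.
Proof.
move=> QP pQ [[pP tP eP] oP].
have eqI (F : R -> R -> R) t : t <= D ->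
    measurable_fun `[0, t] (fun x => F x (P x)) ->
    measurable_fun `[0, t] (fun x => F x (Q x)) ->
    (\int[mu]_(x in `[0%R, t]) (F x (Q x))%:E = \int[mu]_(x in `[0%R, t]) (F x (P x))%:E)%E.
  move=> tD mP mQ; apply: ae_eq_integral => //; try exact/measurable_EFinP.
  apply: filterS QP; first exact: (ae_filter_ringOfSetsType mu).
  move=> x QPx /=; rewrite in_itv/= => /andP[x0 xt]; rewrite QPx// in_itv/= x0.
  exact: le_trans tD.
have mS (f : R -> R) t : t <= D -> measurable_fun `[0, D] f -> measurable_fun `[0, t] f.
  by move=> tD; apply: measurable_funS => //; apply: subset_itvl; rewrite bnd_simp.
have mE (f : R -> R) t : t <= D -> measurable_fun `[0, D] f ->
    measurable_fun `[0, t] (fun x => a * expR (b * x) * f x).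
  move=> tD mf; apply: measurable_funM; last exact: mS mf.
  by apply: measurable_funM => //; exact: measurable_expRM.
have mL (f : R -> R) : measurable_fun `[0, D] f ->
    measurable_fun `[0, D] (fun x => 2^-1 * log2 (1 + f x)).
  move=> mf; apply: measurable_funM => //; apply: measurable_funM => //.
  by apply: measurableT_comp; [exact: measurable_ln|exact: measurable_funD].
have [mP _] := pP; have [mQ _] := pQ.
split; last first.
  move=> P' /oP; rewrite /throughput.
  by rewrite (eqI (fun _ y => 2^-1 * log2 (1 + y)))//; exact: mL.
split => //.
- move=> t tD; have := tP t tD; rewrite /temperature.
  have {}tD : t <= D by move: tD; rewrite in_itv/= => /andP[].
  by rewrite (eqI (fun x y => a * expR (b * x) * y))//; exact: mE.
- move=> t tD; have := eP t tD.
  have {}tD : t <= D by move: tD; rewrite in_itv/= => /andP[].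
  by rewrite (eqI (fun x y => y))//; exact: mS.
Qed.

End AlmostEverywhere.

Theorem lemma6 (R : realType) (D a b Te Tc : R) (N : nat) (s E : nat -> R)
  (hD : 0 < D) (ha : 0 < a) (hb : 0 < b) (hT : Te < Tc)
  (hE : forall i : nat, (i <= N)%N -> 0 < E i)
  (hs0 : s 0%N = 0) (hsD : s N.+1 = D)
  (hs : forall i : nat, (i <= N)%N -> s i < s i.+1)
  (P : R -> R) (hP : optimal_policy D a b Te Tc N s E P) :
  exists Q : R -> R,
    [/\ optimal_policy D a b Te Tc N s E Q,
        {ae @lebesgue_measure R, forall t : R, t \in `[0, D] -> Q t = P t}
      & forall i : nat, (i <= N)%N ->
          {in `]s i, s i.+1[ &, nonincreasing_fun Q}].
Proof.
(* Values outside [0, D] are arbitrary; setting them to 0 makes sign and integrability hold on the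
   whole line. *)
pose p := P \_ `[0, D].
have pE t : t \in `[0, D] -> p t = P t by move=> tD; rewrite /p patchE mem_set.
have [[[mP P0] _ eP] _] := hP.
have p0 t : 0 <= p t.
  by rewrite /p patchE; case: ifPn => // /set_mem; exact: P0.
have mp : measurable_fun setT p by apply/(measurable_restrictT _ _).1.
have ip : lebesgue_measure.-integrable setT (EFin \o p).
  rewrite -restrict_EFin; apply/(integrable_mkcond _ _).1 => //.
  apply/integrableP; split; first exact/measurable_EFinP.
  (* Integrability comes from energy causality at the deadline: the total energy is finite. *)
  have := eP D; rewrite in_itv/= hD lexx => /(_ isT).
  move=> /le_lt_trans-/(_ _ (ltry _)); apply: le_lt_trans.
  rewrite le_eqVlt; apply/orP; left; apply/eqP; apply: eq_integral => x xD /=.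
  by rewrite ger0_norm// P0//; move/set_mem: xD.
have optp : optimal_policy D a b Te Tc N s E p.
  apply: optimal_policy_ae hP.
    by apply: aeW => t; exact: pE.
  by split => [|t _]; [exact: measurable_funTS|exact: p0].
have p_out x : ~ `[0, D]%classic x -> p x = 0 by move=> xD; rewrite /p patchE memNset.
have regp := ae_regular_time b ip p_out.
have aeQ := ae_monotone_version ha hb hT hs0 hsD hs optp p0 ip regp.
exists (monotone_version b N s p); split.
- apply: (optimal_policy_ae aeQ _ optp); split.
    exact: (measurable_monotone_version ha hb hT hs0 hsD hs optp p0 ip regp).
  move=> t; rewrite in_itv/=.
  exact: (monotone_version_ge0 ha hb hT hs0 hsD hs optp p0 ip regp).
- apply: filterS (aeQ); first exact: (ae_filter_ringOfSetsType (@lebesgue_measure R)).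
  by move=> t Qt tD; rewrite Qt// pE.
- exact: (monotone_version_nonincreasing ha hb hT hs0 hsD hs optp p0 ip regp).
Qed.
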